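(* Let $p$ be a prime, $a$ an integer with $p\nmid a$, and $\chi$ a Dirichlet character modulo $p^m$ ($m\ge1$). Let $n\ge m$ and $k\ge0$ be integers with $\chi(-1)\ne(-1)^k$. If $p\ge5$, or $p\in\{2,3\}$ and $n\ge2$, then $$(1-\chi(a)a^{k+1})L(-k,\chi)\equiv\chi(a)a^k\sum_{j=1}^{p^n-1}\chi(j)j^k\left\lfloor\frac{ja}{p^n}\right\rfloor\pmod{p^n}.$$
   Context: $L(-k,\chi)=-B_{k+1,\chi}/(k+1)$ is the value of the Dirichlet $L$-function $L(s,\chi)=\sum_{n\ge1}\chi(n)n^{-s}$ at $s=-k$, where $\sum_{k\ge0}B_{k,\chi}t^k/k!=\sum_{a=1}^f\chi(a)te^{at}/(e^{ft}-1)$ for $\chi$ modulo $f$. $\lfloor x\rfloor$ is the floor function. All quantities lie in the cyclotomic field generated by the values of $\chi$; $x\equiv y\pmod{p^n}$ means $(x-y)/p^n$ is integral at every prime above $p$. *)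

(* Defs.v *)
From HB Require Import structures.
From mathcomp Require Import all_boot all_order all_algebra all_field.
Set Implicit Arguments. Unset Strict Implicit. Unset Printing Implicit Defensive.
Import Order.TTheory GRing.Theory Num.Theory.
Local Open Scope ring_scope.

(* A Dirichlet character modulo N, with values in algC (the values are 0 or
   roots of unity, hence lie in a cyclotomic subfield of algC). *)
Definition dirichlet_char (N : nat) (chi : int -> algC) : Prop :=
  [/\ chi 1 = 1,
      (forall x y : int, chi (x * y) = chi x * chi y),
      (forall x : int, chi (x + N%:Z) = chi x) &
      (forall x : int, chi x = 0 <-> ~~ coprime `|x|%N N)].

(* Generalized Bernoulli numbers B_{k,chi} for chi modulo f, defined by
   sum_k B_k t^k/k! = sum_{a=1}^f chi(a) t e^{at} / (e^{ft} - 1),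
   i.e. (sum_k B_k t^k/k!) * (e^{ft} - 1) = sum_{a=1}^f chi(a) t e^{at}
   as formal power series; written coefficientwise (coefficient of t^n).
   This identity determines the sequence B uniquely. *)
Definition gen_bernoulli (f : nat) (chi : int -> algC) (B : nat -> algC) : Prop :=
  forall n : nat,
    \sum_(k < n) (B k / (k`!)%:R) * ((f ^ (n - k))%:R / ((n - k)`!)%:R)
    = \sum_(1 <= a < f.+1) chi a%:Z *
        (if n is n'.+1 then (a ^ n')%:R / (n'`!)%:R else 0).

Definition Lneg (B : nat -> algC) (k : nat) : algC := - B k.+1 / (k.+1)%:R.

(* z is integral at every prime above p: some d with p not dividing d has
   d * z an algebraic integer. *)
Definition p_integral (p : nat) (z : algC) : Prop :=
  exists d : nat, ~~ (p %| d)%N /\ (d%:R * z \in Aint).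

Definition congr_pn (p n : nat) (x y : algC) : Prop :=
  p_integral p ((x - y) / (p ^ n)%:R).

(* Main.v *)
(* Let N = p^n, S = sum_{0 <= x < N} chi(x) x^(k+1), j a = N q_j + r_j with
   0 <= r_j < N, and c = chi(a) a^(k+1).  The r_j permute the residues mod N, so
   expanding r_j^(k+1) = (j a - N q_j)^(k+1) gives
     (1 - c) S = - (k+1) N chi(a) a^k sum_j chi(j) j^k q_j + O(N^2),
   while S = N B_{k+1} + (k+1)/2 N^2 B_k + O(N^3), where B_k = 0 by parity.
   Dividing by -(k+1) N gives the congruence, once the error terms are bounded.
   Their denominators are i in the first expansion and i(i+1) in the second, and
   N B_r is p-integral.  This suffices except for the terms i = 2 when p is 2 or
   3: the hypothesis n >= 2 makes N B_r divisible by p, and, for p = 2, pairing j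
   with N - j makes sum_j chi(j) j^(k-1) q_j^2 even. *)

Require Import Defs.
From HB Require Import structures.
From mathcomp Require Import all_boot all_order all_algebra all_field.
From mathcomp Require Import cyclic zify ring.
Import Order.TTheory GRing.Theory Num.Theory.
Local Open Scope ring_scope.

(** * p-integral algebraic numbers *)

Lemma p_integral_Aint (p : nat) (x : algC) :
  prime p -> x \in Aint -> p_integral p x.
Proof.
by move=> pr_p Ax; exists 1%N; rewrite mul1r dvdn1 gtn_eqF ?prime_gt1.
Qed.

Lemma p_integralM (p : nat) (x y : algC) :
  prime p -> p_integral p x -> p_integral p y -> p_integral p (x * y).
Proof.
move=> pr_p [d [pd dx]] [e [pe ey]]; exists (d * e)%N.
rewrite Euclid_dvdM // negb_or pd pe; split=> //.
by rewrite natrM mulrACA rpredM.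
Qed.

Lemma p_integralD (p : nat) (x y : algC) :
  prime p -> p_integral p x -> p_integral p y -> p_integral p (x + y).
Proof.
move=> pr_p [d [pd dx]] [e [pe ey]]; exists (d * e)%N.
rewrite Euclid_dvdM // negb_or pd pe; split=> //.
have ->: (d * e)%:R * (x + y) = e%:R * (d%:R * x) + d%:R * (e%:R * y) :> algC.
  by rewrite natrM; ring.
by rewrite rpredD // rpredM // rpred_nat.
Qed.

Lemma p_integral_nat (p i : nat) : prime p -> p_integral p i%:R.
Proof. by move=> pr_p; apply: p_integral_Aint; rewrite // rpred_nat. Qed.

Lemma p_integral_int (p : nat) (i : int) : prime p -> p_integral p i%:~R.
Proof. by move=> pr_p; apply: p_integral_Aint; rewrite // rpred_int. Qed.

Lemma p_integralN (p : nat) (x : algC) :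
  prime p -> p_integral p x -> p_integral p (- x).
Proof.
by move=> pr_p [d [pd dx]]; exists d; split; rewrite // mulrN rpredN.
Qed.

Lemma p_integralB (p : nat) (x y : algC) :
  prime p -> p_integral p x -> p_integral p y -> p_integral p (x - y).
Proof. by move=> pr_p px py; apply/p_integralD/p_integralN. Qed.

Lemma p_integral_sum (p : nat) (I : eqType) (r : seq I) (P : pred I)
    (F : I -> algC) :
  prime p -> {in r, forall i, P i -> p_integral p (F i)} ->
  p_integral p (\sum_(i <- r | P i) F i).
Proof.
move=> pr_p intF; rewrite big_seq_cond.
apply: (big_ind (p_integral p)) => [|x y|i /andP[ri Pi]].
- exact: (p_integral_nat p 0).
- exact: p_integralD.
- exact: intF.
Qed.

(** Write d = e p^v with e prime to p. Then e clears the denominator, since v <= u. *)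
Lemma p_integral_frac (p u d : nat) :
  prime p -> (0 < d)%N -> (logn p d <= u)%N ->
  p_integral p ((p ^ u)%:R / d%:R).
Proof.
move=> pr_p d_gt0 led; have [e pe] := pfactor_coprime pr_p d_gt0.
move: led; set v := logn p d => led d_eq.
have e_gt0: (0 < e)%N by move: d_gt0; rewrite d_eq muln_gt0 => /andP[].
exists e; split; first by rewrite -prime_coprime.
have e0: e%:R != 0 :> algC by rewrite pnatr_eq0 -lt0n.
have p0: (p ^ v)%:R != 0 :> algC by rewrite pnatr_eq0 -lt0n expn_gt0 prime_gt0.
suff ->: e%:R * ((p ^ u)%:R / d%:R) = (p ^ (u - v))%:R :> algC.
  by rewrite rpred_nat.
rewrite d_eq -{1}(subnK led) expnD [(_ * p ^ v)%:R]natrM [(e * _)%:R]natrM.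
by field; rewrite e0 p0.
Qed.

(** * Characters *)

Lemma chi_periodic (N : nat) (chi : int -> algC) :
  dirichlet_char N chi -> forall x y : int, chi (x + y * N%:Z) = chi x.
Proof.
case=> _ _ chiD _ x y.
have Hn (n : nat) z : chi (z + n%:Z * N%:Z) = chi z.
  elim: n z => [|n IHn] z; first by rewrite mul0r addr0.
  by rewrite intS mulrDl mul1r addrA IHn chiD.
case: y => n; first exact: Hn.
by rewrite NegzE -[LHS](Hn n.+1) mulNr subrK.
Qed.

Lemma dirichlet_char_pow (p m n : nat) (chi : int -> algC) :
  (0 < m <= n)%N -> dirichlet_char (p ^ m) chi -> dirichlet_char (p ^ n) chi.
Proof.
move=> /andP[m_gt0 lemn] Hchi; have chiN := chi_periodic _ _ Hchi.
case: Hchi => chi1 chiM chiD chi0; split=> // x.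
  by rewrite -(subnK lemn) expnD PoszM chiN.
by rewrite chi0 !coprime_pexpr // (leq_trans m_gt0).
Qed.

Lemma chi_mod (N : nat) (chi : int -> algC) :
  dirichlet_char N chi -> forall x : int, chi (x %% N%:Z)%Z = chi x.
Proof.
by move=> Hchi x; rewrite {2}(divz_eq x N%:Z) addrC chi_periodic.
Qed.

Lemma chi_exp (N : nat) (chi : int -> algC) :
  dirichlet_char N chi -> forall (x : int) (i : nat), chi (x ^+ i) = chi x ^+ i.
Proof.
case=> chi1 chiM _ _ x; elim=> [|i IHi]; first by rewrite !expr0.
by rewrite !exprS chiM IHi.
Qed.

(** Nonzero values are roots of unity of order dividing phi(N), by Euler's theorem applied to a
    nonnegative representative. *)
Lemma chi_Aint (N : nat) (chi : int -> algC) :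
  (0 < N)%N -> dirichlet_char N chi -> forall x : int, chi x \in Aint.
Proof.
move=> N_gt0 Hchi x; have [chi1 _ _ chi0] := Hchi.
have [y y_eq]: exists y : nat, chi x = chi y%:Z.
  exists `|(x %% N%:Z)%Z|%N; rewrite gez0_abs ?modz_ge0 ?chi_mod //.
  by rewrite -lt0n.
rewrite y_eq; have [cop|ncop] := boolP (coprime y N); last first.
  by have /chi0 -> : ~~ coprime `|y%:Z|%N N by []; rewrite rpred0.
apply: (@Aint_unity_root (totient N)); first by rewrite totient_gt0.
apply/unity_rootP; rewrite -(chi_exp _ _ Hchi) -chi1 -(chi_mod _ _ Hchi).
rewrite -[RHS](chi_mod _ _ Hchi) -rmorphXn /= natrXE !modz_nat.
by rewrite Euler_exp_totient.
Qed.

Lemma chi_N1_sign (N : nat) (chi : int -> algC) :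
  dirichlet_char N chi -> exists s : bool, chi (-1) = (-1) ^+ s.
Proof.
move=> [chi1 chiM _ _]; have: chi (-1) ^+ 2 = 1.
  by rewrite expr2 -chiM mulrNN mulr1.
by move/eqP; rewrite sqrf_eq1 => /orP[]/eqP->; [exists false | exists true].
Qed.

Lemma chi_N1 (N : nat) (chi : int -> algC) (k : nat) :
  dirichlet_char N chi -> chi (-1) != (-1) ^+ k -> chi (-1) = - (-1) ^+ k.
Proof.
move=> /chi_N1_sign[s ->]; rewrite -(signr_odd _ k).
by case: s; case: (odd k); rewrite ?expr1 ?expr0 ?opprK ?eqxx.
Qed.

Lemma chi_nat0 (p n : nat) (chi : int -> algC) : prime p -> (0 < n)%N ->
  dirichlet_char (p ^ n) chi -> forall x : nat, (p %| x)%N -> chi x%:Z = 0.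
Proof.
move=> pr_p n_gt0 [_ _ _ chi0] x px; apply/chi0.
by rewrite /= coprime_pexpr // coprime_sym prime_coprime // px.
Qed.

(** * Power sums and generalized Bernoulli numbers *)

Definition power_sum (chi : int -> algC) (N r : nat) : algC :=
  \sum_(0 <= x < N) chi x%:Z * x%:R ^+ r.

(** The linear functional sending ['X^i] to B_i; at (X + c)^n it gives the generalized Bernoulli
    polynomial B_n(c). *)
Definition umbral (B : nat -> algC) (P : {poly algC}) : algC :=
  \sum_(i < size P) P`_i * B i.

Lemma umbral_widen (B : nat -> algC) (n : nat) (P : {poly algC}) :
  (size P <= n)%N -> umbral B P = \sum_(i < n) P`_i * B i.
Proof.
move=> leP; rewrite /umbral (big_ord_widen n (fun i => P`_i * B i)) //.
rewrite big_mkcond /=; apply: eq_bigr => i _.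
by case: ltnP => // lePi; rewrite nth_default // mul0r.
Qed.

Lemma umbral_is_scalar (B : nat -> algC) : scalar (umbral B).
Proof.
move=> c P Q; pose n := maxn (size P) (size Q).
have lecPQ : (size (c *: P + Q)%R <= n)%N.
  rewrite (leq_trans (size_polyD _ _)) // geq_max leq_maxr andbT.
  by rewrite (leq_trans (size_scale_leq _ _)) // leq_maxl.
rewrite (umbral_widen _ _ _ lecPQ) (umbral_widen B n P) ?leq_maxl //.
rewrite (umbral_widen B n Q) ?leq_maxr // mulr_sumr -big_split /=.
by apply: eq_bigr => i _; rewrite coefD coefZ mulrDl mulrA.
Qed.

HB.instance Definition _ (B : nat -> algC) :=
  GRing.isLinear.Build algC {poly algC} algC *%R (umbral B)
    (umbral_is_scalar B).

Lemma umbralXn (B : nat -> algC) (n : nat) : umbral B 'X^n = B n.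
Proof.
rewrite (umbral_widen B n.+1) ?size_polyXn // big_ord_recr /= coefXn eqxx mul1r.
rewrite big1 ?add0r // => i _; rewrite coefXn ltn_eqF ?mul0r //.
Qed.

Lemma umbral_XaddC_exp (B : nat -> algC) (c : algC) (n : nat) :
  umbral B (('X + c%:P) ^+ n)
  = \sum_(i < n.+1) 'C(n, i)%:R * c ^+ (n - i) * B i.
Proof.
rewrite addrC exprDn linear_sum; apply: eq_bigr => i _ /=.
by rewrite -rmorphXn /= mul_polyC -scaler_nat scalerA linearZ /= umbralXn.
Qed.

(* [gen_bernoulli] in umbral form; unlike the power series identity it passes
   from [f] to its multiples by telescoping, see [bernoulli_rec_mul]. *)
Definition bernoulli_rec (f : nat) (chi : int -> algC) (B : nat -> algC) :=
  forall n, umbral B (('X + f%:R%:P) ^+ n) - B n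
            = n%:R * power_sum chi f n.-1.

Lemma sum_chi_shift (chi : int -> algC) (N : nat) (F : nat -> algC) :
  (0 < N)%N -> chi 0 = 0 -> chi N%:Z = 0 ->
  \sum_(1 <= x < N.+1) chi x%:Z * F x = \sum_(0 <= x < N) chi x%:Z * F x.
Proof.
move=> N_gt0 chi0 chiN; rewrite big_nat_recr //= chiN mul0r addr0.
by rewrite [RHS]big_ltn // chi0 mul0r add0r.
Qed.

(** Multiplying the coefficient of t^n by n! turns quotients of factorials into binomials;
    subtracting B_n removes the top term, which the defining sum over k < n omits. *)
Lemma gen_bernoulli_rec (f : nat) (chi : int -> algC) (B : nat -> algC) :
  (0 < f)%N -> chi 0 = 0 -> chi f%:Z = 0 -> gen_bernoulli f chi B ->
  bernoulli_rec f chi B.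
Proof.
move=> f_gt0 chi0 chif genB n.
rewrite umbral_XaddC_exp big_ord_recr /= binn subnn expr0 !mul1r addrK.
have nz (i : nat) : i`!%:R != 0 :> algC by rewrite pnatr_eq0 -lt0n fact_gt0.
have: n`!%:R * (\sum_(k < n) (B k / (k`!)%:R) *
         ((f ^ (n - k))%:R / ((n - k)`!)%:R)) = 
   n%:R * power_sum chi f n.-1.
  rewrite genB sum_chi_shift // /power_sum !mulr_sumr.
  apply: eq_bigr => x _; case: n => [|n /=]; first by rewrite !(mul0r, mulr0).
  by rewrite factS natrM natrX; field; rewrite nz.
move=> <-; rewrite mulr_sumr; apply: eq_bigr => -[k ltkn] _ /=.
rewrite -(bin_fact (ltnW ltkn)) !natrM natrX.
by field; rewrite !nz.
Qed.

(** Both sides are linear in P, and the recurrence is the case of monomials. *)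
Lemma bernoulli_rec_poly (f : nat) (chi : int -> algC) (B : nat -> algC) :
  bernoulli_rec f chi B -> forall P : {poly algC},
  umbral B (P \Po ('X + f%:R%:P)) - umbral B P
  = \sum_(0 <= x < f) chi x%:Z * P^`().[x%:R].
Proof.
move=> recB P; rewrite -[P]coefK poly_def.
rewrite [X in umbral B X - _]linear_sum /=.
rewrite !linear_sum -sumrB /=.
transitivity (\sum_(i < size P) \sum_(0 <= x < f)
     chi x%:Z * (P`_i * (i%:R * x%:R ^+ i.-1))).
  apply: eq_bigr => i _; rewrite !linearZ /= comp_Xn_poly umbralXn -mulrBr recB.
  rewrite /power_sum !mulr_sumr; apply: eq_bigr => x _; ring.
rewrite exchange_big /=; apply: eq_bigr => x _.
rewrite -mulr_sumr; congr (_ * _); rewrite horner_sum.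
apply: eq_bigr => i _.
by rewrite linearZ /= hornerZ derivXn hornerMn hornerXn mulr_natl.
Qed.

Lemma bernoulli_rec_mul (f q : nat) (chi : int -> algC) (B : nat -> algC) :
  (forall x y : int, chi (x + y * f%:Z) = chi x) ->
  bernoulli_rec f chi B -> bernoulli_rec (q * f) chi B.
Proof.
move=> chiD recB n; rewrite /power_sum big_nat_mul mulr_sumr.
pose P (i : nat) : {poly algC} := ('X + (i * f)%:R%:P) ^+ n.
(* Each difference accounts for the block of arguments x + i f with 0 <= x < f, on which chi only
   sees x. *)
transitivity (\sum_(0 <= i < q) (umbral B (P i.+1) - umbral B (P i))).
  by rewrite telescope_sumr // /P mul0n addr0 umbralXn.
apply: eq_bigr => i _; have := bernoulli_rec_poly _ _ _ recB (P i).
have -> : P i \Po ('X + f%:R%:P) = P i.+1.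
  rewrite /P rmorphXn /= rmorphD /= comp_polyX comp_polyC mulSn.
  rewrite natrD rmorphD /=.
  by rewrite addrA.
move=> ->; rewrite -[in RHS](add0n (i * f)%N) big_addn mulSn addnK mulr_sumr.
apply: eq_bigr => x _.
have -> : (x + i * f)%N%:Z = x%:Z + i%:Z * f%:Z :> int by rewrite PoszD PoszM.
rewrite chiD deriv_exp derivD derivX derivC addr0 mul1r hornerMn horner_exp.
by rewrite hornerD hornerX hornerC natrD -mulr_natl mulrCA mulrA.
Qed.

(** In the recurrence at n + 1 the terms in B_{n+1} cancel, and B_n then has the nonzero coefficient
    (n + 1) f. *)
Lemma bernoulli_rec_uniq (f : nat) (chi : int -> algC) (B B' : nat -> algC) :
  (0 < f)%N -> bernoulli_rec f chi B -> bernoulli_rec f chi B' -> B =1 B'.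
Proof.
move=> f_gt0 recB recB'; elim/ltn_ind => n IHn.
have := recB' n.+1; rewrite -recB !umbral_XaddC_exp.
rewrite 2!big_ord_recr [in RHS]big_ord_recr [in RHS]big_ord_recr /=.
rewrite binn subnn expr0 !mul1r !addrK subSnn expr1 binSn.
rewrite (eq_bigr (fun i : 'I_n => 'C(n.+1, i)%:R * f%:R ^+ (n.+1 - i) * B i)).
  by move/addrI/mulfI => -> //; rewrite mulf_neq0 // pnatr_eq0 // -lt0n.
by move=> i _; rewrite IHn.
Qed.

(** The recurrence at n + 1, divided by n + 1 and read in reverse order, is an expansion in powers
    of N with leading term N B_n. *)
Lemma power_sum_bernoulli (N : nat) (chi : int -> algC) (B : nat -> algC) :
  bernoulli_rec N chi B -> forall n,
  power_sum chi N n
  = \sum_(i < n.+1) 'C(n, i)%:R / i.+1%:R * N%:R ^+ i.+1 * B (n - i)%N.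
Proof.
move=> recB n; have nz : n.+1%:R != 0 :> algC by rewrite pnatr_eq0.
apply: (mulfI nz); have := recB n.+1 => /= <-.
rewrite umbral_XaddC_exp big_ord_recr /= binn subnn expr0 !mul1r addrK.
rewrite (reindex_inj rev_ord_inj) /= mulr_sumr; apply: eq_bigr => -[i /= lti] _.
have lein : (i <= n)%N by [].
have iz : i.+1%:R != 0 :> algC by rewrite pnatr_eq0.
have -> : 'C(n.+1, n.+1 - i.+1)%:R = n.+1%:R * 'C(n, i)%:R / i.+1%:R :> algC.
  by rewrite bin_sub // -natrM (mul_bin_diag n.+1 i) natrM mulrC mulKf.
by rewrite subSS subSn ?leq_subr // subKn //; ring.
Qed.

(** * Parity of the generalized Bernoulli numbers *)

Lemma sum_nat_reflect (V : nmodType) (N : nat) (F : nat -> V) :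
  F 0%N = F N -> \sum_(0 <= x < N) F x = \sum_(0 <= x < N) F (N - x)%N.
Proof.
case: N => [|N] F0; first by rewrite !big_geq.
(* The reflection sends 0 to N, outside the range, so this term is treated apart. *)
rewrite big_ltn // [RHS]big_ltn // subn0 F0; congr (_ + _).
by rewrite big_nat_rev; apply: eq_bigr => x _; rewrite add1n subSS.
Qed.

Lemma chi_reflect (N : nat) (chi : int -> algC) :
  dirichlet_char N chi -> forall x : nat, (x <= N)%N ->
  chi (N - x)%N%:Z = chi (-1) * chi x%:Z.
Proof.
move=> [_ chiM chiD _] x lexN.
by rewrite -subzn // addrC chiD -chiM mulN1r.
Qed.

(** The twisted sequence [B'] satisfies the same recurrence as B, so uniqueness identifies them. *)
Lemma bernoulli_parity (f : nat) (chi : int -> algC) (B : nat -> algC) :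
  (0 < f)%N -> dirichlet_char f chi -> chi 0 = 0 -> bernoulli_rec f chi B ->
  forall n, B n = chi (-1) * (-1) ^+ n * B n.
Proof.
move=> f_gt0 Hchi chi0 recB; pose B' n := chi (-1) * (-1) ^+ n * B n.
apply: (bernoulli_rec_uniq f chi B B') => // n.
have umbB' (P : {poly algC}) :
    umbral B' P = chi (-1) * umbral B (P \Po (- 'X)).
  rewrite comp_polyE linear_sum mulr_sumr; apply: eq_bigr => i _ /=.
  rewrite linearZ exprNn -signr_odd; case: (boolP (odd i)) => oddi.
    by rewrite expr1 mulN1r linearN /= umbralXn /B' -signr_odd oddi expr1; ring.
  by rewrite mul1r /= umbralXn /B' -signr_odd (negPf oddi) expr0; ring.
have chif : chi f%:Z = 0.
  by have [_ _ chiD _] := Hchi; rewrite -[f%:Z]add0r chiD.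
(* Chosen so that X -> X + f turns P into (-X)^n: the two values of [umbral B'] become values of
   [umbral B] at these polynomials. *)
pose P : {poly algC} := (- 'X + f%:R%:P) ^+ n.
have := bernoulli_rec_poly _ _ _ recB P.
have -> : P \Po ('X + f%:R%:P) = 'X^n \Po (- 'X).
  rewrite /P comp_Xn_poly rmorphXn /= rmorphD rmorphN /= comp_polyX comp_polyC.
  by rewrite opprD addrNK.
move=> eqP; rewrite -[B' n](umbralXn B') !umbB'.
have -> : ('X + f%:R%:P) ^+ n \Po - 'X = P.
  by rewrite rmorphXn /= rmorphD /= comp_polyX comp_polyC.
rewrite -mulrBr -opprB eqP /power_sum [in RHS](sum_nat_reflect _ f); last first.
  by rewrite chi0 chif !mul0r.
rewrite mulrN -mulNr [LHS]mulr_sumr [RHS]mulr_sumr.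
apply: eq_big_nat => x /andP[_ ltx].
rewrite (chi_reflect f) 1?ltnW // deriv_exp derivD derivN derivX derivC addr0.
rewrite hornerMn hornerM horner_exp hornerD !hornerN hornerX !hornerC.
by rewrite natrB 1?ltnW // [_ + f%:R]addrC -mulr_natl; ring.
Qed.

Lemma bernoulli_eq0 (f : nat) (chi : int -> algC) (B : nat -> algC) (k : nat) :
  (0 < f)%N -> dirichlet_char f chi -> chi 0 = 0 -> bernoulli_rec f chi B ->
  chi (-1) = - (-1) ^+ k -> B k = 0.
Proof.
move=> f_gt0 Hchi chi0 recB chiN1.
have := bernoulli_parity f chi B f_gt0 Hchi chi0 recB k.
rewrite chiN1 mulNr -exprMn mulrNN mulr1 expr1n mulN1r => /eqP.
by rewrite -addr_eq0 -mulr2n mulrn_eq0 /= => /eqP.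
Qed.

(** * Denominators of power sums and Bernoulli numbers *)

Lemma logn_leq_exp (b p i u : nat) :
  (1 < b <= p)%N -> (0 < i < b ^ u.+1)%N -> (logn p i <= u)%N.
Proof.
move=> /andP[b_gt1 lebp] /andP[i_gt0 lti].
(* With v = [logn p i], b^v <= p^v <= i < b^(u+1). A fixed base b serves all primes p >= b at
   once. *)
rewrite -ltnS -(ltn_exp2l _ _ b_gt1) (leq_ltn_trans _ lti) //.
rewrite (leq_trans _ (dvdn_leq i_gt0 (pfactor_dvdnn p i))) //.
by case: (logn p i) => // v; rewrite leq_exp2r.
Qed.

Lemma power_sum_integral (p n r : nat) (chi : int -> algC) :
  prime p -> dirichlet_char (p ^ n) chi ->
  p_integral p (power_sum chi (p ^ n) r).
Proof.
move=> pr_p Hchi; apply: p_integral_sum => // x _ _.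
apply: p_integral_Aint => //; rewrite rpredM ?rpredX ?rpred_nat //.
by apply: chi_Aint Hchi _; rewrite expn_gt0 prime_gt0.
Qed.

(** Strong induction: the power sum expansion is solved for N B_r. Each other term has a factor
    N^(i+1)/(i+2), p-integral because i + 2 < 2^(i+2), times an earlier N B_s. *)
Lemma bernoulli_integral (p n : nat) (chi : int -> algC) (B : nat -> algC) :
  prime p -> (0 < n)%N -> dirichlet_char (p ^ n) chi ->
  bernoulli_rec (p ^ n) chi B -> forall r, p_integral p ((p ^ n)%:R * B r).
Proof.
move=> pr_p n_gt0 Hchi recB; elim/ltn_ind => r IHr.
have := power_sum_bernoulli _ _ _ recB r; rewrite big_ord_recl /=.
rewrite bin0 divr1 expr1 mul1r subn0 => /eqP; rewrite -subr_eq => /eqP <-.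
apply: p_integralB => //; first exact: power_sum_integral.
apply: p_integral_sum => // -[i /= ltir] _ _; rewrite /bump /= add1n.
have -> : 'C(r, i.+1)%:R / i.+2%:R * (p ^ n)%:R ^+ i.+2 * B (r - i.+1)%N =
    'C(r, i.+1)%:R * ((p ^ (n * i.+1))%:R / i.+2%:R)
      * ((p ^ n)%:R * B (r - i.+1)%N).
  by rewrite exprS -[_ ^+ i.+1]natrX -expnM; ring.
apply: p_integralM => //; last by apply: IHr; lia.
apply: p_integralM => //; first exact: p_integral_nat.
apply: p_integral_frac => //; apply: (@leq_trans i.+1); last by nia.
by apply: (logn_leq_exp 2); rewrite ?prime_gt1 //= ltn_expl.
Qed.

(* With [M = p ^ n.-1], the map [i |-> chi (1 + i M)] is a character of Z/p, so
   the sum over a fibre of Z/p^n -> Z/M is either 0 or [p * chi x]. *)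
Lemma chi_fibre_sum (p n x : nat) (chi : int -> algC) :
  prime p -> (2 <= n)%N -> dirichlet_char (p ^ n) chi ->
  p_integral p ((\sum_(0 <= i < p) chi (x + i * p ^ n.-1)%N%:Z) / p%:R).
Proof.
move=> pr_p n_ge2 Hchi; have chiN := chi_periodic _ _ Hchi.
have [chi1 chiM _ _] := Hchi; set M := (p ^ n.-1)%N.
have NE : (p ^ n = p * M)%N by rewrite -expnS; congr (_ ^ _)%N; lia.
have pM : (p %| M)%N by rewrite dvdn_exp //; lia.
have p0 : p%:R != 0 :> algC by rewrite pnatr_eq0 -lt0n prime_gt0.
have n_gt0 : (0 < n)%N by lia.
have [px|npx] := boolP (p %| x)%N.
  rewrite big1 ?mul0r; first exact: (p_integral_nat p 0).
  move=> i _; apply: (chi_nat0 p n) => //.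
  by rewrite dvdn_addr // dvdn_mull.
pose w := chi (1 + M)%N%:Z.
have chi_w i : chi (1 + i * M)%N%:Z = w ^+ i.
  elim: i => [|i IHi]; first by rewrite expr0.
  rewrite exprSr -IHi -chiM.
  (* Hence (1 + iM)(1 + M) = 1 + (i+1)M modulo p^n. *)
  have [t tE] : exists t, (M * M = t * p ^ n)%N.
    by apply/dvdnP; rewrite NE mulnC dvdn_mul.
  rewrite -(chiN (1 + i.+1 * M)%N%:Z (i * t)%N%:Z); congr chi.
  rewrite -!(PoszM, PoszD); congr Posz.
  by rewrite -mulnA -tE; ring.
have wp : w ^+ p = 1.
  by rewrite -chi_w -NE -chi1 -[RHS](chiN 1 1); congr chi; rewrite mul1r PoszD.
(* An inverse y of x modulo p gives x + iM = x (1 + iyM) modulo p^n, so the fibre sum is chi(x)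
   times a geometric sum of ratio w^y. *)
have xy : (x * x ^ (totient p).-1 = 1 %[mod p])%N.
  rewrite -expnS prednK ?totient_gt0 ?prime_gt0 //.
  by rewrite Euler_exp_totient // coprime_sym prime_coprime.
move: xy; set y := (x ^ _)%N; rewrite [in RHS]modn_small ?prime_gt1 // => xy.
have [t xy1] : exists t, (x * y = t * p + 1)%N.
  by exists (x * y %/ p)%N; rewrite {1}(divn_eq (x * y) p) xy.
have chi_v i : chi (x + i * M)%N%:Z = chi x%:Z * (w ^+ y) ^+ i.
  rewrite -exprM -chi_w -chiM.
  rewrite -(chiN (x + i * M)%N%:Z (i * t)%N%:Z); congr chi.
  rewrite -!(PoszM, PoszD); congr Posz; rewrite NE.
  rewrite [RHS](_ : _ = x + i * M * (x * y))%N; last by ring.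
  by rewrite xy1; ring.
rewrite (eq_bigr _ (fun i _ => chi_v i)) -mulr_sumr -mulrA.
apply: p_integralM => //.
  apply: p_integral_Aint => //; apply: chi_Aint Hchi _.
  by rewrite expn_gt0 prime_gt0.
have [->|v1] := eqVneq (w ^+ y) 1.
  under eq_bigr do rewrite expr1n.
  rewrite sumr_const_nat subn0 divff //; exact: (p_integral_nat p 1).
suff -> : \sum_(0 <= i < p) (w ^+ y) ^+ i = 0.
  rewrite mul0r; exact: (p_integral_nat p 0).
have v1' : w ^+ y - 1 != 0 by rewrite subr_eq0.
(* The ratio is a p-th root of unity other than 1, so its geometric sum vanishes. *)
apply: (mulfI v1'); rewrite mulr0 big_mkord -subrX1.
by rewrite exprAC wp expr1n subrr.
Qed.

(** Group the arguments by residue x modulo M. Since (x + iM)^r = x^r modulo p, each inner sum is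
    x^r times a fibre sum, itself divisible by p, up to a multiple of p. *)
Lemma power_sum_integral_p (p n r : nat) (chi : int -> algC) :
  prime p -> (2 <= n)%N -> dirichlet_char (p ^ n) chi ->
  p_integral p (power_sum chi (p ^ n) r / p%:R).
Proof.
move=> pr_p n_ge2 Hchi; set M := (p ^ n.-1)%N.
have NE : (p ^ n = p * M)%N by rewrite -expnS; congr (_ ^ _)%N; lia.
have pM : (p %| M)%N by rewrite dvdn_exp //; lia.
have p0 : p%:R != 0 :> algC by rewrite pnatr_eq0 -lt0n prime_gt0.
have -> : power_sum chi (p ^ n) r =
  \sum_(0 <= x < M) \sum_(0 <= i < p)
     chi (x + i * M)%N%:Z * (x + i * M)%:R ^+ r.
  rewrite exchange_big /= /power_sum NE big_nat_mul; apply: eq_bigr => i _.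
  by rewrite -[in LHS](add0n (i * M)%N) big_addn mulSn addnK.
rewrite mulr_suml; apply: p_integral_sum => // x _ _.
have xr i : exists z : int,
    (x + i * M)%:R ^+ r = x%:R ^+ r + p%:R * z%:~R :> algC.
  have e : ((x + i * M) ^ r = x ^ r %[mod p])%N.
    rewrite -modnXm -modnDmr; have /eqP -> : (p %| i * M)%N by rewrite dvdn_mull.
    by rewrite addn0 modnXm.
  exists (((x + i * M) ^ r %/ p)%N%:Z - (x ^ r %/ p)%N%:Z).
  rewrite -!natrX [in LHS](divn_eq ((x + i * M) ^ r) p) [in LHS]e.
  rewrite [X in _ = X%:R + _](divn_eq (x ^ r) p).
  by rewrite rmorphB /= !natrD !natrM; ring.
have -> : (\sum_(0 <= i < p) chi (x + i * M)%N%:Z * (x + i * M)%:R ^+ r) / p%:R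
  = x%:R ^+ r * ((\sum_(0 <= i < p) chi (x + i * M)%N%:Z) / p%:R)
   + \sum_(0 <= i < p) chi (x + i * M)%N%:Z *
        (((x + i * M)%:R ^+ r - x%:R ^+ r) / p%:R).
  rewrite !mulr_suml mulr_sumr -big_split /=; apply: eq_bigr => i _; ring.
apply: p_integralD => //.
  apply: p_integralM => //; last exact: chi_fibre_sum.
  by rewrite -natrX; apply: p_integral_nat.
apply: p_integral_sum => // i _ _; apply: p_integralM => //.
  apply: p_integral_Aint => //; apply: chi_Aint Hchi _.
  by rewrite expn_gt0 prime_gt0.
have [z ->] := xr i; rewrite addrAC subrr add0r mulrAC divff // mul1r.
exact: p_integral_int.
Qed.

Lemma bernoulli_integral_p (p n : nat) (chi : int -> algC) (B : nat -> algC) :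
  prime p -> (2 <= n)%N -> dirichlet_char (p ^ n) chi ->
  bernoulli_rec (p ^ n) chi B ->
  forall r, p_integral p ((p ^ n)%:R * B r / p%:R).
Proof.
move=> pr_p n_ge2 Hchi recB r.
have n_gt0 : (0 < n)%N by lia.
have p0 : p%:R != 0 :> algC by rewrite pnatr_eq0 -lt0n prime_gt0.
have := power_sum_bernoulli _ _ _ recB r; rewrite big_ord_recl /=.
rewrite bin0 divr1 expr1 mul1r subn0 => /eqP; rewrite -subr_eq => /eqP <-.
rewrite mulrBl.
apply: p_integralB => //; first exact: power_sum_integral_p.
rewrite mulr_suml.
apply: p_integral_sum => // -[i /= ltir] _ _; rewrite /bump /= add1n.
(* One factor p of N^(i+1) is spent on the division by p; n >= 2 leaves u >= i + 1, still enough for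
   the denominator i + 2. *)
have [u uE] : exists u, (n * i.+1 = u.+1)%N by exists (n * i.+1).-1; nia.
have -> : 'C(r, i.+1)%:R / i.+2%:R * (p ^ n)%:R ^+ i.+2 * B (r - i.+1)%N / p%:R =
    'C(r, i.+1)%:R * ((p ^ u)%:R / i.+2%:R)
      * ((p ^ n)%:R * B (r - i.+1)%N).
  rewrite exprS -[_ ^+ i.+1]natrX -expnM uE expnS natrM.
  have: i.+2%:R != 0 :> algC by rewrite pnatr_eq0.
  by move: i.+2%:R => c c0; field; rewrite p0 c0.
apply: p_integralM => //; last exact: bernoulli_integral Hchi recB _.
apply: p_integralM => //; first exact: p_integral_nat.
apply: p_integral_frac => //; apply: (@leq_trans i.+1); last by nia.
by apply: (logn_leq_exp 2); rewrite ?prime_gt1 //= ltn_expl.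
Qed.

(** * The sums of floors *)

(** All powers i of the quotients occur in the binomial expansion of r_j^(k+1); i = 1 gives the sum
    of the theorem. *)
Definition floor_sum (chi : int -> algC) (N : nat) (a : int) (r i : nat) :
    algC :=
  \sum_(0 <= j < N) chi j%:Z * j%:R ^+ r * ((j%:Z * a) %/ N%:Z)%Z%:~R ^+ i.

(** Multiplication by a is injective on residues modulo N, hence permutes them. *)
Lemma sum_mul_modz (N : nat) (a : int) (F : int -> algC) :
  (0 < N)%N -> coprimez N%:Z a ->
  \sum_(0 <= j < N) F ((j%:Z * a) %% N%:Z)%Z = \sum_(0 <= j < N) F j%:Z.
Proof.
move=> N_gt0 copNa; rewrite !big_mkord.
have N0 : N%:Z != 0 by rewrite -lt0n.
have modE (j : 'I_N) : (`|((j : nat)%:Z * a) %% N%:Z|%Z)%N%:Z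
    = ((j : nat)%:Z * a %% N%:Z)%Z by rewrite gez0_abs ?modz_ge0.
have ltN (j : 'I_N) : (`|((j : nat)%:Z * a) %% N%:Z|%Z < N)%N.
  by rewrite -ltz_nat modE ltz_pmod.
pose h j := Ordinal (ltN j).
have h_inj : injective h.
  move=> j k /(congr1 (fun i : 'I_N => (i : nat)%:Z)) /=; rewrite !modE => /eqP.
  rewrite eqz_mod_dvd -mulrBl Gauss_dvdzl // -eqz_mod_dvd.
  rewrite !modz_nat !modn_small ?ltn_ord // => /eqP[jk].
  exact: val_inj.
rewrite [RHS](reindex_inj h_inj) /=; apply: eq_bigr => j _.
by rewrite modE.
Qed.

(* Write [j a = N q_j + r_j]: the residues [r_j] permute those prime to [p], and
   [r_j ^ r = (j a - N q_j) ^ r] is expanded by the binomial formula. *)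
Lemma power_sum_floor (N : nat) (chi : int -> algC) (a : int) (r : nat) :
  (0 < N)%N -> coprimez N%:Z a -> dirichlet_char N chi ->
  power_sum chi N r
  = chi a * \sum_(i < r.+1) 'C(r, i)%:R * a%:~R ^+ (r - i) * (- N%:R) ^+ i
              * floor_sum chi N a (r - i) i.
Proof.
move=> N_gt0 copNa Hchi.
have -> : power_sum chi N r = \sum_(0 <= j < N) chi j%:Z * j%:Z%:~R ^+ r by [].
rewrite -(sum_mul_modz N a (fun x => chi x * x%:~R ^+ r)) //.
under [in RHS]eq_bigr do rewrite /floor_sum mulr_sumr.
rewrite exchange_big /= mulr_sumr; apply: eq_bigr => j _.
have [_ chiM _ _] := Hchi.
rewrite (chi_mod _ _ Hchi) chiM.
set q := ((j%:Z * a) %/ N%:Z)%Z.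
have -> : ((j%:Z * a) %% N%:Z)%Z%:~R = j%:R * a%:~R + (- N%:R) * q%:~R :> algC.
  have -> : (j%:Z * a %% N%:Z)%Z = j%:Z * a - q * N%:Z.
    by rewrite [X in _ = X - _](divz_eq (j%:Z * a) N%:Z) addrC addKr.
  by rewrite rmorphB !rmorphM /= ; ring.
rewrite exprDn !mulr_sumr; apply: eq_bigr => i _.
by rewrite !exprMn -mulr_natl; ring.
Qed.

(** If j a = q N + r, then (N - j) a = (a - 1 - q) N + (N - r), and r != 0 makes N - r a proper
    remainder. *)
Lemma divz_reflect (N : nat) (a j : int) :
  (0 < N)%N -> ~~ (N%:Z %| j * a)%Z ->
  ((N%:Z - j) * a %/ N%:Z)%Z = a - 1 - (j * a %/ N%:Z)%Z.
Proof.
move=> N_gt0 ndv; have N0 : N%:Z != 0 by rewrite -lt0n.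
set q := (j * a %/ N%:Z)%Z; pose r := (j * a %% N%:Z)%Z.
have r_ge0 : 0 <= r by rewrite modz_ge0.
have r0 : r != 0 by apply: contra ndv => /eqP r0; apply/dvdz_mod0P.
have ltrN : r < N%:Z by rewrite ltz_pmod.
have -> : (N%:Z - j) * a = (a - 1 - q) * N%:Z + (N%:Z - r).
  by rewrite mulrBl {1}(divz_eq (j * a) N%:Z) -/q -/r; ring.
rewrite divzMDl // divz_small ?addr0 //; lia.
Qed.

Lemma sum_nat_pairs (V : nmodType) (M : nat) (F : nat -> V) :
  F M = F (M + M)%N ->
  \sum_(0 <= j < M + M) F j = \sum_(0 <= j < M) (F j + F (M + M - j)%N).
Proof.
move=> FM; rewrite (@big_cat_nat _ _ _ M) ?leq_addr //= big_split /=.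
congr (_ + _); rewrite -{1}[M]add0n big_addn addnK.
(* Reflecting the upper half exchanges its end M for 2M, which [FM] allows. *)
rewrite sum_nat_reflect ?add0n //.
by apply: eq_big_nat => j /andP[_ ltj]; rewrite addnC addnBA // ltnW.
Qed.

(** For odd j the quotients at j and N - j are q and a - 1 - q, of equal parity as a is odd, and
    chi(N - j) = chi(j) up to sign. Each pair thus contributes chi(j) times an even integer. *)
Lemma floor_sum_even (n r : nat) (chi : int -> algC) (a : int) :
  (2 <= n)%N -> ~~ (2 %| a)%Z -> dirichlet_char (2 ^ n) chi ->
  p_integral 2 (floor_sum chi (2 ^ n) a r 2 / 2).
Proof.
move=> n_ge2 odda Hchi; have [u nE] : exists u, n = u.+2 by exists n.-2; lia.
have n_gt0 : (0 < n)%N by lia.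
pose M := (2 ^ u.+1)%N; have NE : (2 ^ n = M + M)%N by rewrite nE expnS; lia.
have evM : (2 %| M)%N by rewrite /M expnS dvdn_mulr.
have chi0 := chi_nat0 2 n chi isT n_gt0 Hchi.
rewrite /floor_sum NE sum_nat_pairs; last first.
  by rewrite !chi0 ?dvdn_add // !mul0r.
rewrite mulr_suml -NE; apply: p_integral_sum => // j; rewrite mem_index_iota.
move=> /andP[_ ltjM] _; have lejN : (j <= 2 ^ n)%N by rewrite NE; lia.
rewrite (chi_reflect _ _ Hchi) //.
have [evj|oddj] := boolP (2 %| j)%N.
  rewrite (chi0 j) // !(mulr0, mul0r, addr0); exact: (p_integral_nat 2 0).
rewrite -(subzn lejN) divz_reflect ?expn_gt0 //; last first.
  apply/negP => dv; have: (2 %| j%:Z * a)%Z.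
    by apply: dvdz_trans dv; rewrite dvdzE /= dvdn_exp.
  by rewrite dvdzE abszM Euclid_dvdM // -!dvdzE (negPf odda) orbF; apply/negP.
set q := (_ %/ _)%Z; set w := a - 1 - q.
have [s sE] := chi_N1_sign _ _ Hchi.
pose z : int := j%:Z ^+ r * q ^+ 2
  + (-1) ^+ s * (2 ^ n - j)%N%:Z ^+ r * w ^+ 2.
have -> : (chi j%:Z * j%:R ^+ r * q%:~R ^+ 2 +
    chi (-1) * chi j%:Z * (2 ^ n - j)%:R ^+ r * w%:~R ^+ 2) / 2
   = chi j%:Z * (z%:~R / 2).
  have -> : z%:~R = j%:R ^+ r * q%:~R ^+ 2 + (-1) ^+ s * (2 ^ n - j)%:R ^+ r
      * w%:~R ^+ 2 :> algC.
    by rewrite /z intrD !intrM !rmorphXn /= rmorphN rmorph1.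
  by rewrite sE; ring.
apply: p_integralM => //.
  by apply: p_integral_Aint => //; apply: chi_Aint Hchi _; rewrite expn_gt0.
(* In ['F_2] the numbers [j], [a] and [2 ^ n - j] are 1, so [q] and [w] agree. *)
suff /dvdzP[t ->] : (2 %| z)%Z.
  by rewrite rmorphM /= mulfK ?pnatr_eq0 //; apply: p_integral_int.
have F2 : 2%N \in [pchar 'F_2] by exact: pchar_Fp.
have toF2 (x : int) : x%:~R = (~~ (2 %| x)%Z)%:R :> 'F_2.
  rewrite (dvdz_pcharf F2); case: (x%:~R) => -[|[|//]] i; exact: val_inj.
have j1 : j%:Z%:~R = 1 :> 'F_2 by rewrite toF2 dvdzE oddj.
have a1 : a%:~R = 1 :> 'F_2 by rewrite toF2 odda.
have Nj1 : (2 ^ n - j)%N%:Z%:~R = 1 :> 'F_2.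
  by rewrite toF2 dvdzE /= dvdn_subr ?dvdn_exp // oddj.
rewrite (dvdz_pcharf F2) /z intrD !intrM !rmorphXn /= /w !intrB.
rewrite j1 Nj1 a1 rmorph1 subrr sub0r mulrNN rmorphN rmorph1.
by rewrite (oppr_pchar2 F2) !expr1n !mul1r (addrr_pchar2 F2).
Qed.

(** At most one of i and i + 1 is divisible by p, so the bound for a single factor suffices. *)
Lemma logn_mul_succ (b p i u : nat) :
  prime p -> (1 < b <= p)%N -> (0 < i)%N -> (i.+1 < b ^ u.+1)%N ->
  (logn p (i * i.+1) <= u)%N.
Proof.
move=> pr_p bp i_gt0 lti; rewrite lognM //.
have [pi|npi] := boolP (p %| i)%N.
  rewrite (@lognE p i.+1) pr_p /= -addn1 dvdn_addr // dvdn1.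
  rewrite gtn_eqF ?prime_gt1 // addn0.
  by apply: (logn_leq_exp b) => //; lia.
rewrite (@lognE p i) pr_p (negPf npi) i_gt0 /= add0n.
by apply: (logn_leq_exp b).
Qed.

(** * The congruence *)

Lemma bernoulli_term_integral (p n i c : nat) (chi : int -> algC)
    (B : nat -> algC) (r : nat) :
  prime p -> (0 < n)%N -> (5 <= p)%N \/ (2 <= n)%N ->
  dirichlet_char (p ^ n) chi -> bernoulli_rec (p ^ n) chi B ->
  p_integral p (c%:R * (p ^ n)%:R ^+ i.+1 / (i.+2 * i.+3)%:R * B r).
Proof.
move=> pr_p n_gt0 pn Hchi recB.
have p0 : p%:R != 0 :> algC by rewrite pnatr_eq0 -lt0n prime_gt0.
(* Normally N^i absorbs the denominator, leaving N B_r. For i = 0 and n >= 2 the denominator is 6,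
   and a factor p is taken from N B_r instead. *)
have [led|[i0 n_ge2]] : (logn p (i.+2 * i.+3) <= n * i)%N \/
    i = 0%N /\ (2 <= n)%N.
  case: pn => [p_ge5|n_ge2].
    left; apply: (@leq_trans i); last by nia.
    apply: (logn_mul_succ 5) => //.
    by elim: (i) => // j IHj; rewrite expnS; lia.
  case: i => [|i]; [by right | left].
  apply: (@leq_trans (2 * i.+1)); last by nia.
  apply: (logn_mul_succ 2); rewrite ?prime_gt1 //.
  by elim: i => // j IHj; rewrite mulnS 2!expnS; lia.
- have -> : c%:R * (p ^ n)%:R ^+ i.+1 / (i.+2 * i.+3)%:R * B r =
      c%:R * ((p ^ (n * i))%:R / (i.+2 * i.+3)%:R) * ((p ^ n)%:R * B r).
    by rewrite exprS -[_ ^+ i]natrX -expnM; ring.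
  apply: p_integralM => //; last exact: bernoulli_integral Hchi recB _.
  apply: p_integralM => //; first exact: p_integral_nat.
  exact: p_integral_frac.
- rewrite i0.
  have -> : c%:R * (p ^ n)%:R ^+ 1 / (2 * 3)%:R * B r =
      c%:R * ((p ^ 1)%:R / (2 * 3)%:R) * ((p ^ n)%:R * B r / p%:R).
    by rewrite expr1 expn1; field.
  apply: p_integralM => //; last exact: bernoulli_integral_p Hchi recB _.
  apply: p_integralM => //; first exact: p_integral_nat.
  apply: p_integral_frac => //.
  by apply: (logn_mul_succ 2); rewrite ?prime_gt1.
Qed.

Lemma floor_sum_integral (p n : nat) (a : int) (chi : int -> algC) (r i : nat) :
  prime p -> dirichlet_char (p ^ n) chi ->
  p_integral p (floor_sum chi (p ^ n) a r i).
Proof.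
move=> pr_p Hchi; apply: p_integral_sum => // j _ _.
apply: p_integral_Aint => //; rewrite !rpredM ?rpredX ?rpred_nat ?rpred_int //.
by apply: chi_Aint Hchi _; rewrite expn_gt0 prime_gt0.
Qed.

Lemma floor_term_integral (p n i : nat) (a : int) (chi : int -> algC)
    (r : nat) :
  prime p -> (0 < n)%N -> (2 < p)%N \/ (2 <= n)%N -> ~~ (p %| a)%Z ->
  dirichlet_char (p ^ n) chi ->
  p_integral p ((p ^ n)%:R ^+ i / i.+2%:R * floor_sum chi (p ^ n) a r i.+2).
Proof.
move=> pr_p n_gt0 pn npa Hchi.
have intT := floor_sum_integral p n a chi r _ pr_p Hchi.
(* N^i absorbs i + 2 except in half of the sum of squared quotients at p = 2, where evenness is
   used. *)
have [led|[i0 p2]] : (logn p i.+2 <= n * i)%N \/ i = 0%N /\ p = 2%N.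
  case: i => [|i]; last first.
    left; apply: (@leq_trans i.+1); last by nia.
    apply: (logn_leq_exp 2); rewrite ?prime_gt1 //=.
    by elim: i => // j IHj; rewrite expnS; lia.
  have [p_gt2|] := ltnP 2 p.
    by left; rewrite muln0 (logn_leq_exp 3).
  by have := prime_gt1 pr_p; right; lia.
- by rewrite -natrX -expnM; apply: p_integralM => //; apply: p_integral_frac.
- rewrite i0 p2 in npa Hchi pn *; have n_ge2 : (2 <= n)%N by case: pn.
  by rewrite expr0 mul1r mulrC; apply: floor_sum_even.
Qed.

Theorem theorem3p1 (p : nat) (a : int) (m : nat) (chi : int -> algC)
    (B : nat -> algC) (n k : nat) :
  prime p -> ~~ (p%:Z %| a)%Z -> (1 <= m)%N ->
  dirichlet_char (p ^ m) chi -> gen_bernoulli (p ^ m) chi B ->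
  (m <= n)%N -> chi (-1) != (-1) ^+ k ->
  (5 <= p)%N \/ ((p == 2%N) || (p == 3%N)) /\ (2 <= n)%N ->
  congr_pn p n
    ((1 - chi a * a%:~R ^+ k.+1) * Lneg B k)
    (chi a * a%:~R ^+ k *
      \sum_(1 <= j < p ^ n) chi j%:Z * (j%:R ^+ k) *
        ((j%:Z * a) %/ (p ^ n)%:Z)%Z%:~R).
Proof.
move=> pr_p npa m_gt0 Hchi_m genB lemn chiN1 pn; have n_gt0 : (0 < n)%N by lia.
have Hchi : dirichlet_char (p ^ n) chi.
  by apply: dirichlet_char_pow Hchi_m; rewrite m_gt0.
have p_pow_gt0 i : (0 < p ^ i)%N by rewrite expn_gt0 prime_gt0.
have chi0 : chi 0 = 0 by apply: (chi_nat0 p n chi pr_p n_gt0 Hchi 0).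
have recB : bernoulli_rec (p ^ n) chi B.
  rewrite -(subnK lemn) expnD; apply: bernoulli_rec_mul.
    exact: chi_periodic Hchi_m.
  apply: gen_bernoulli_rec => //.
  by apply: (chi_nat0 p m) => //; rewrite dvdn_exp.
have Bk0 : B k = 0.
  apply: (bernoulli_eq0 (p ^ n) chi) => //.
  exact: chi_N1 Hchi chiN1.
have coNa : coprimez (p ^ n)%N%:Z a.
  by rewrite coprimezE /= coprimeXl // prime_coprime // -dvdzE.
have nz i : i.+1%:R != 0 :> algC by rewrite pnatr_eq0.
(* This extracts k + 1 from every error term, so that dividing by k + 1 creates no new
   denominator. *)
have binE i : 'C(k.+1, i.+2)%:R = k.+1%:R * 'C(k, i.+1)%:R / i.+2%:R :> algC.
  by rewrite -natrM (mul_bin_diag k.+1 i.+1) natrM mulrC mulKf.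
pose N : algC := (p ^ n)%:R; have N0 : N != 0 by rewrite pnatr_eq0 -lt0n.
(* [U] and [V] are the tails of the Bernoulli and floor expansions from the third term on, divided
   by (k+1) N^2; [V] also omits the factor chi(a). *)
pose U := \sum_(i < k) 'C(k, i.+1)%:R * N ^+ i.+1 / (i.+2 * i.+3)%:R
                         * B (k - i.+1)%N.
pose V := \sum_(i < k) 'C(k, i.+1)%:R * a%:~R ^+ (k - i.+1) * (-1) ^+ i
            * (N ^+ i / i.+2%:R * floor_sum chi (p ^ n) a (k - i.+1) i.+2).
have powS : power_sum chi (p ^ n) k.+1 = N * B k.+1 + k.+1%:R * N ^+ 2 * U.
  rewrite (power_sum_bernoulli _ _ _ recB) 2!big_ord_recl /= /bump /= !subn0.
  rewrite addn0 subSS subn0 Bk0 mulr0 add0r bin0 divr1 expr1 mul1r.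
  congr (_ + _); rewrite mulr_sumr; apply: eq_bigr => i _.
  rewrite !add1n subSS binE natrM -/N !(exprS N) expr0.
  have := nz i.+2; have := nz i.+1.
  by move: i.+2%:R i.+3%:R => c d c0 d0; field; rewrite c0 d0.
have := power_sum_floor _ _ _ k.+1 (p_pow_gt0 n) coNa Hchi.
rewrite 2!big_ord_recl /= /bump /= !subn0 addn0 subSS subn0 bin0 bin1.
rewrite !expr0 mulr1 mul1r expr1.
have -> : floor_sum chi (p ^ n) a k.+1 0 = power_sum chi (p ^ n) k.+1.
  by apply: eq_bigr => j _; rewrite expr0 mulr1.
have -> : floor_sum chi (p ^ n) a k 1 = \sum_(1 <= j < p ^ n)
    chi j%:Z * j%:R ^+ k * ((j%:Z * a) %/ (p ^ n)%:Z)%Z%:~R.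
  rewrite /floor_sum big_ltn // chi0 !mul0r add0r.
  by apply: eq_bigr => j _; rewrite expr1.
set T1 := \sum_(1 <= j < _) _.
rewrite [X in _ = _ * (_ + (_ + X)) -> _](_ : _ = k.+1%:R * N ^+ 2 * V);
    last first.
  rewrite mulr_sumr; apply: eq_bigr => i _.
  rewrite !add1n subSS binE exprNn -/N !(exprS N) !(exprS (-1)) expr0; ring.
rewrite powS -/N.
(* Equating the two expansions of S and dividing by -(k+1) N^2 isolates the error exactly; only its
   integrality remains. *)
move=> H; have {}H : ((1 - chi a * a%:~R ^+ k.+1) * Lneg B k
     - chi a * a%:~R ^+ k * T1) / N
     = (1 - chi a * a%:~R ^+ k.+1) * U - chi a * V.
  have k0 := nz k; have kN0 : k.+1%:R * N ^+ 2 != 0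
    by rewrite mulf_neq0 ?expf_neq0.
  apply: (mulfI kN0); move/eqP: H; rewrite -subr_eq0 => /eqP H.
  rewrite -[RHS]subr0 -[X in _ = _ - X]H /Lneg -/N.
  by move: k.+1%:R k0 => c c0; field; rewrite c0 N0.
have int_chi x : p_integral p (chi x).
  by apply: p_integral_Aint => //; apply: chi_Aint Hchi _.
have int_a i : p_integral p (a%:~R ^+ i).
  by rewrite -rmorphXn; apply: p_integral_int.
rewrite /congr_pn H; apply: p_integralB => //; apply: p_integralM => //.
- apply: p_integralB => //; first exact: (p_integral_nat p 1).
  exact: p_integralM.
- apply: p_integral_sum => // i _ _.
  apply: bernoulli_term_integral Hchi recB => //.
  by case: pn => [|[]]; [left | right].
apply: p_integral_sum => // i _ _; apply: p_integralM => //.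
  apply: p_integralM => //; last first.
    by rewrite -signr_odd; case: odd; [apply: (p_integral_int p (-1)) |
      apply: (p_integral_nat p 1)].
  by apply: p_integralM => //; apply: p_integral_nat.
by apply: floor_term_integral => //; case: pn => [|[]]; [left; lia | right].
Qed.
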